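(* Let $n\ge 2$, let $H$ be an oriented $(n-1)$-dimensional linear subspace of $\mathbb{R}^n$, let $X=\mathcal{M}(\mathbb{R}^n)$, $\mathcal{M}_+(\mathbb{R}^n)$, $\mathcal{S}(\mathbb{R}^n)$, or $\mathcal{V}(\mathbb{R}^n)$, and suppose that $T:X\to X$ is pointwise with respect to $H$, with associated functions $F^+,F^-:D^2\to D$. Then $T$ is equimeasurable if and only if $$\{F^+(r,s),F^-(s,r)\}=\{r,s\}$$ for all $(r,s)\in D^2$.
   Context: $\mathcal{H}^n$ is $n$-dimensional Hausdorff (Lebesgue) measure on $\mathbb{R}^n$. $\mathcal{M}(\mathbb{R}^n)$ (respectively $\mathcal{M}_+(\mathbb{R}^n)$) is the set of real-valued (respectively nonnegative real-valued) $\mathcal{H}^n$-measurable functions on $\mathbb{R}^n$. $\mathcal{S}(\mathbb{R}^n)$ is the set of $f\in\mathcal{M}(\mathbb{R}^n)$ with $\mathcal{H}^n(\{x:f(x)>t\})<\infty$ for all real $t>\operatorname{ess\,inf} f$ (where $\operatorname{ess\,inf} f=-\infty$ is allowed). $\mathcal{V}(\mathbb{R}^n)$ is the set of $f\in\mathcal{M}_+(\mathbb{R}^n)$ with $\mathcal{H}^n(\{x:f(x)>t\})<\infty$ for all $t>0$. The orientation of $H$ determines the two closed half-spaces $H^+$ and $H^-$ bounded by $H$. For $x\in\mathbb{R}^n$, $x^\dagger$ is the reflection of $x$ in $H$, and $f^\dagger(x)=f(x^\dagger)$. $D=\{f(x):x\in\mathbb{R}^n,\ f\in X\}$; thus $D=\mathbb{R}$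 if $X=\mathcal{M}(\mathbb{R}^n)$ or $\mathcal{S}(\mathbb{R}^n)$, and $D=[0,\infty)$ if $X=\mathcal{M}_+(\mathbb{R}^n)$ or $\mathcal{V}(\mathbb{R}^n)$. A map $T:X\to X$ is pointwise with respect to $H$ if there are functions $F^+,F^-:D^2\to D$ (the functions associated with $T$) that coincide on the diagonal $\{(s,s):s\in D\}$, such that for all $f\in X$, $Tf(x)=F^+(f(x),f^\dagger(x))$ if $x\in H^+$ and $Tf(x)=F^-(f(x),f^\dagger(x))$ if $x\in H^-$. $T$ is equimeasurable if $\mathcal{H}^n(\{x:Tf(x)>t\})=\mathcal{H}^n(\{x:f(x)>t\})$ for all $f\in X$ and $t\in\mathbb{R}$. *)

(* Defs.v *)
From HB Require Import structures.
From mathcomp Require Import all_boot all_order all_algebra.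
From mathcomp Require Import all_classical all_reals all_analysis.
From mathcomp Require Import ess_sup_inf.

Set Implicit Arguments.
Unset Strict Implicit.
Unset Printing Implicit Defensive.

Import Order.TTheory GRing.Theory Num.Theory.
Import numFieldNormedType.Exports.
Local Open Scope classical_set_scope.
Local Open Scope ring_scope.

(* The norm that MathComp-Analysis puts on row vectors is the max norm, so the
   Euclidean structure of R^n is defined explicitly. *)
Definition dot (R : realType) (n : nat) (x y : 'rV[R]_n) : R :=
  \sum_(i < n) x ord0 i * y ord0 i.

Definition enorm (R : realType) (n : nat) (x : 'rV[R]_n) : R :=
  Num.sqrt (dot x x).

(* ereal_sup set0 = -oo, so this is the usual diameter on nonempty sets only. *)
Definition diam (R : realType) (n : nat) (A : set 'rV[R]_n) : \bar R :=
  ereal_sup [set (enorm (x - y))%:E | x in A & y in A].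

(* Volume of the Euclidean unit ball of R^n, pi^(n/2) / Gamma(n/2 + 1). *)
Fixpoint ball_volume (R : realType) (n : nat) : R :=
  match n with
  | 0 => 1
  | 1 => 2
  | m.+2 => 2 * pi / m.+2%:R * ball_volume R m
  end.

(* The empty set contributes 0 to a covering sum, also when n = 0. *)
Definition hausdorff_weight (R : realType) (n : nat) (A : set 'rV[R]_n) :
    \bar R :=
  (if A == set0 then 0 else (ball_volume R n / 2 ^+ n)%:E * diam A ^+ n)%E.

Definition hausdorff_delta (R : realType) (n : nat) (delta : R)
    (A : set 'rV[R]_n) : \bar R :=
  ereal_inf [set (\sum_(k <oo) hausdorff_weight (C k))%E | C in
    [set C : (set 'rV[R]_n)^nat |
      A `<=` \bigcup_k C k /\ forall k, (diam (C k) <= delta%:E)%E]].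

(* n-dimensional Hausdorff outer measure on R^n.  hausdorff_delta is
   nonincreasing in delta, so the supremum is the limit as delta -> 0+; with
   the factor ball_volume n / 2^n it is Lebesgue outer measure. *)
Definition hausdorff (R : realType) (n : nat) (A : set 'rV[R]_n) : \bar R :=
  ereal_sup [set hausdorff_delta delta A | delta in [set d : R | 0 < d]].
Arguments hausdorff {R n} A.

Section hausdorff_outer_measure.
Context (R : realType) (n : nat).
Local Open Scope ereal_scope.
Implicit Types (A : set 'rV[R]_n) (d : R).

Lemma ball_volume_gt0 (m : nat) : (0 < ball_volume R m)%R.
Proof.
suff: (0 < ball_volume R m)%R /\ (0 < ball_volume R m.+1)%R by case.
elim: m => [|m [IH1 IH2]]; first by split => /=.
split => //=; apply: mulr_gt0 => //.
by rewrite divr_gt0// mulr_gt0// pi_gt0.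
Qed.

Lemma diam_ge0 A : A !=set0 -> 0 <= diam A.
Proof.
move=> [x Ax]; apply: ereal_sup_ubound; exists x => //; exists x => //.
rewrite subrr /enorm /dot big1 ?sqrtr0// => i _.
by rewrite mxE mul0r.
Qed.

Lemma hausdorff_weight_ge0 A : 0 <= hausdorff_weight A.
Proof.
rewrite /hausdorff_weight; case: ifPn => // /set0P A0.
rewrite mule_ge0//; last by apply: expe_ge0; exact: diam_ge0.
by rewrite lee_fin divr_ge0 ?exprn_ge0// ltW// ball_volume_gt0.
Qed.

Lemma hausdorff_delta_ge0 d A : 0 <= hausdorff_delta d A.
Proof.
apply: le_ereal_inf_tmp => _ [C _ <-].
by apply: nneseries_ge0 => k _ _; exact: hausdorff_weight_ge0.
Qed.

Lemma hausdorff_delta0 d : hausdorff_delta d (set0 : set 'rV[R]_n) = 0.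
Proof.
apply/eqP; rewrite eq_le hausdorff_delta_ge0 andbT.
apply: ereal_inf_lbound; exists (fun=> set0).
  split=> // k; rewrite /diam (_ : [set _ | _ in _ & _ in _] = set0).
    by rewrite ereal_sup0 leNye.
  by apply/seteqP; split => // ? [].
by apply: eseries0 => k _ _; rewrite /hausdorff_weight eqxx.
Qed.

Lemma le_hausdorff_delta d :
  {homo (@hausdorff_delta R n d) : A B / A `<=` B >-> A <= B}.
Proof.
move=> A B AB; apply: ereal_inf_le_tmp => _ [C [BC dC] <-].
by exists C => //; split => //; exact: subset_trans BC.
Qed.

Lemma hausdorff_delta_sigma_subadditive d :
  sigma_subadditive (@hausdorff_delta R n d).
Proof.
move=> A; have [[i ioo]|] := pselect (exists i, hausdorff_delta d (A i) = +oo).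
  rewrite (eseries_pinfty _ _ ioo) ?leey// => k _.
  by rewrite -ltNye (lt_le_trans _ (hausdorff_delta_ge0 _ _)).
rewrite -forallNE => Aoo; apply/lee_addgt0Pr => e e0.
rewrite (le_trans _ (epsilon_trick _ _ (ltW e0)))//; last first.
  by move=> k; exact: hausdorff_delta_ge0.
pose P k (B : (set 'rV[R]_n)^nat) :=
  (A k `<=` \bigcup_j B j /\ forall j, diam (B j) <= d%:E) /\
  \sum_(j <oo) hausdorff_weight (B j) <=
    hausdorff_delta d (A k) + (e / (2 ^ k.+1)%:R)%:E.
have [G PG] : {G : ((set 'rV[R]_n)^nat)^nat & forall k, P k (G k)}.
  apply: (@choice _ _ P) => k; rewrite /P.
  have ek : (0 < e / (2 ^ k.+1)%:R)%R by rewrite divr_gt0// ltr0n expn_gt0.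
  have fk : hausdorff_delta d (A k) \is a fin_num.
    rewrite ge0_fin_numE ?hausdorff_delta_ge0// ltey; exact/eqP/Aoo.
  have [_ [B cB <-] lB] := lb_ereal_inf_adherent ek fk.
  by exists B; split => //; exact: ltW.
pose w (ij : nat * nat) := hausdorff_weight (G ij.1 ij.2).
have w0 x : 0 <= w x by exact: hausdorff_weight_ge0.
apply: (@le_trans _ _ (\esum_(i in setT) w i)).
  have /card_esym/ppcard_eqP[f] := card_nat2.
  apply: ereal_inf_lbound => /=.
  exists (uncurry G \o f).
    split => [t [i _ At]|k]; last first.
      by rewrite /=; case: (f k) => i j; exact: (PG i).1.2.
    have [j _ Gt] := (PG i).1.1 t At.
    by exists (f^-1%FUN (i, j)) => //=; rewrite invK ?inE.
  transitivity (\sum_(k <oo) w (f k)).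
    by apply: eq_eseriesr => k _; rewrite /w /=; case: (f k).
  rewrite -(esum_pred_image w f xpredT) ?[fun=> _]set_true//.
  by rewrite image_eq.
rewrite (_ : esum _ _ = \sum_(i <oo) \sum_(j <oo) hausdorff_weight (G i j)).
  apply: lee_nneseries => [k _ _|k _]; last exact: (PG k).2.
  by apply: nneseries_ge0 => j _ _; exact: hausdorff_weight_ge0.
pose J : nat -> set (nat * nat) := fun i => [set (i, j) | j in setT].
rewrite (_ : setT = \bigcup_k J k); last first.
  by rewrite predeqE => -[a b]; split => // _; exists a => //; exists b.
rewrite esum_bigcupT//; last first.
  apply/trivIsetP => i j _ _ ij.
  rewrite predeqE => -[a m] /=; split => //= -[] [_] _ [<-{a} _].
  by move=> [m' _] [] /esym/eqP; rewrite (negbTE ij).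
rewrite -(image_id [set: nat]) -fun_true esum_pred_image//; last first.
  by move=> k _; exact: esum_ge0.
apply: eq_eseriesr => /= j _.
rewrite -(esum_pred_image w (pair j) predT)//=; last first.
  by move=> ? ? _ _; exact: (@can_inj _ _ _ snd).
by congr esum; rewrite predeqE => -[a b]; split; move=> [i _ <-]; exists i.
Qed.

Lemma hausdorff0 : hausdorff (set0 : set 'rV[R]_n) = 0.
Proof.
apply/eqP; rewrite eq_le; apply/andP; split.
  by apply: ge_ereal_sup => _ [d _ <-]; rewrite hausdorff_delta0.
by apply: ereal_sup_ubound; exists 1%R => //=; exact: hausdorff_delta0.
Qed.

Lemma hausdorff_ge0 A : 0 <= hausdorff A.
Proof.
apply: (le_trans (hausdorff_delta_ge0 1 A)).
by apply: ereal_sup_ubound; exists 1%R => //=.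
Qed.

Lemma le_hausdorff :
  {homo (@hausdorff R n) : A B / A `<=` B >-> A <= B}.
Proof.
move=> A B AB; apply: ge_ereal_sup => _ [d d0 <-].
apply: (le_trans (le_hausdorff_delta d AB)).
by apply: ereal_sup_ubound; exists d.
Qed.

Lemma hausdorff_sigma_subadditive : sigma_subadditive (@hausdorff R n).
Proof.
move=> A; apply: ge_ereal_sup => _ [d d0 <-].
apply: (le_trans (hausdorff_delta_sigma_subadditive d A)).
apply: lee_nneseries => k *; first exact: hausdorff_delta_ge0.
by apply: ereal_sup_ubound; exists d.
Qed.

HB.instance Definition _ := isOuterMeasure.Build R 'rV[R]_n (@hausdorff R n)
  hausdorff0 hausdorff_ge0 le_hausdorff hausdorff_sigma_subadditive.

End hausdorff_outer_measure.

(* R^n with the sigma-algebra of H^n-measurable (Caratheodory) sets. *)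
Definition hausdorff_sigma_type (R : realType) (n : nat) :=
  caratheodory_type (@hausdorff R n).
HB.instance Definition _ (R : realType) (n : nat) :=
  Measurable.on (hausdorff_sigma_type R n).

Definition hausdorff_measure (R : realType) (n : nat) :
    set (hausdorff_sigma_type R n) -> \bar R := @hausdorff R n.
HB.instance Definition _ (R : realType) (n : nat) :=
  isMeasure.Build _ (hausdorff_sigma_type R n) R (@hausdorff_measure R n)
    (@caratheodory_measure0 R 'rV[R]_n (@hausdorff R n))
    (@caratheodory_measure_ge0 R 'rV[R]_n (@hausdorff R n))
    (@caratheodory_measure_sigma_additive R 'rV[R]_n (@hausdorff R n)).
Arguments hausdorff_measure {R n} A.

Section function_classes.
Context (R : realType) (n : nat).
Local Notation Hn := (@hausdorff_measure R n).

Definition M_class : set ('rV[R]_n -> R) :=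
  [set f | measurable_fun [set: hausdorff_sigma_type R n] f].

Definition Mplus_class : set ('rV[R]_n -> R) :=
  [set f | M_class f /\ forall x, 0 <= f x].

Definition S_class : set ('rV[R]_n -> R) :=
  [set f | M_class f /\
    forall t : R, (ess_inf Hn (EFin \o f) < t%:E)%E ->
      (Hn [set x | (t < f x)%R] < +oo)%E].

Definition V_class : set ('rV[R]_n -> R) :=
  [set f | Mplus_class f /\
    forall t : R, 0 < t -> (Hn [set x | (t < f x)%R] < +oo)%E].

End function_classes.
Arguments M_class {R n} f.
Arguments Mplus_class {R n} f.
Arguments S_class {R n} f.
Arguments V_class {R n} f.

(* An (n-1)-dimensional linear subspace of R^n; the orientation is the choice
   of one of its two unit normals. *)
Record oriented_hyperplane (R : realType) (n : nat) := OrientedHyperplane {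
  hyperplane :> {vspace 'rV[R]_n};
  dim_hyperplane : \dim hyperplane = n.-1;
  unit_normal : 'rV[R]_n;
  enorm_unit_normal : enorm unit_normal = 1;
  dot_unit_normal : forall x, x \in hyperplane -> dot x unit_normal = 0
}.

Section two_point.
Context (R : realType) (n : nat).
Implicit Types (H : oriented_hyperplane R n) (X : set ('rV[R]_n -> R)).

Definition halfspace_plus H : set 'rV[R]_n := [set x | 0 <= dot x (unit_normal H)].

Definition halfspace_minus H : set 'rV[R]_n := [set x | dot x (unit_normal H) <= 0].

Definition reflection H (x : 'rV[R]_n) : 'rV[R]_n :=
  x - (2 * dot x (unit_normal H)) *: unit_normal H.

Definition value_set X : set R := [set f x | f in X & x in [set: 'rV[R]_n]].

Definition pointwise_map H X (T : ('rV[R]_n -> R) -> ('rV[R]_n -> R))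
    (Fplus Fminus : R * R -> R) : Prop :=
  (forall s, value_set X s -> Fplus (s, s) = Fminus (s, s)) /\
  (forall f, X f -> forall x,
     (halfspace_plus H x -> T f x = Fplus (f x, f (reflection H x))) /\
     (halfspace_minus H x -> T f x = Fminus (f x, f (reflection H x)))).

Definition equimeasurable X (T : ('rV[R]_n -> R) -> ('rV[R]_n -> R)) : Prop :=
  forall f, X f -> forall t : R,
    hausdorff_measure [set x | t < T f x] = hausdorff_measure [set x | t < f x].

End two_point.

(* Main.v *)
Require Import Defs.
From mathcomp Require Import all_boot all_order all_algebra.
From mathcomp Require Import all_classical all_reals all_analysis.
From mathcomp Require Import ess_sup_inf ring lra.

(** Mirror points [x] and [reflection H x], the former on the positive side,
    form a pair on which [f] takes two values [r] and [s], and [T f] takes the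
    values [Fplus (r, s)] and [Fminus (s, r)].

    If these are always the same two values, then every superlevel set of [T f]
    meets each mirror pair in as many points as the superlevel set of [f] and
    agrees with it on [H], where both points of the pair coincide.  The measure
    of a measurable set only depends on these data ([hausdorff_fold]), because
    Hausdorff measure is invariant under the reflection and both open sides of
    [H] are measurable.

    Conversely, let [E] be a cube on the positive side of [H], let [f] be [r] on
    [E], [s] on its mirror image and a constant [c] elsewhere.  Constants are
    fixed by [T], so [T f] is [p = Fplus (r, s)] on [E], [q = Fminus (s, r)] on
    the mirror image and [c] elsewhere.  If [c] is a lower bound of [p], [q],
    [r], [s], comparing the measures of superlevel sets at levels [t >= c] shows
    that as many of [p], [q] as of [r], [s] exceed [t], which forces the two
    pairs to agree ([threshold_count_eq]).  Such a [c] with [f] in the class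
    always exists ([test_fun_class]).

    The argument uses three facts about Hausdorff measure on [R^n].  Sets
    defined by [0 < g] with [g] Lipschitz are measurable
    ([hausdorff_caratheodory_gt0]); this is applied to the two sides of [H] and
    to cubes.  A cube has finite measure, by an explicit subdivision
    ([hausdorff_cube_lty]).  A cube has positive measure
    ([hausdorff_cube_gt0]): by compactness it suffices to bound the radii of
    finitely many balls covering it, and counting the points of a fine grid does
    so ([cube_cover_volume]). *)

Set Implicit Arguments.
Unset Strict Implicit.
Unset Printing Implicit Defensive.

Import Order.TTheory GRing.Theory Num.Theory.
Import numFieldNormedType.Exports.
Local Open Scope classical_set_scope.
Local Open Scope ring_scope.

(** * Euclidean norm, maximum norm and reflection *)

Section euclidean.
Context {R : realType} {n : nat}.
Implicit Types (x y z : 'rV[R]_n) (H : oriented_hyperplane R n).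

Lemma dotC x y : dot x y = dot y x.
Proof. by apply: eq_bigr => i _; rewrite mulrC. Qed.

Lemma dotDl x y z : dot (x + y) z = dot x z + dot y z.
Proof. by rewrite /dot -big_split; apply: eq_bigr => i _; rewrite mxE mulrDl. Qed.

Lemma dotZl (a : R) x y : dot (a *: x) y = a * dot x y.
Proof. by rewrite /dot mulr_sumr; apply: eq_bigr => i _; rewrite mxE mulrA. Qed.

Lemma dotBl x y z : dot (x - y) z = dot x z - dot y z.
Proof. by rewrite dotDl -scaleN1r dotZl mulN1r. Qed.

Lemma dot_ge0 x : 0 <= dot x x.
Proof. by apply: sumr_ge0 => i _; rewrite -expr2 sqr_ge0. Qed.

Lemma enorm_sqr x : enorm x ^+ 2 = dot x x.
Proof. by rewrite sqr_sqrtr // dot_ge0. Qed.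

(** Taking [u] of norm one, [a] equal to [dot x u] gives Cauchy-Schwarz, and [a]
    equal to twice [dot x u] shows that reflections preserve the norm. *)
Lemma dot_subZ x u (a : R) :
  dot (x - a *: u) (x - a *: u) = dot x x - 2 * a * dot x u + a ^+ 2 * dot u u.
Proof.
rewrite dotBl dotZl !(dotC _ (x - _)) !dotBl !dotZl (dotC u x).
ring.
Qed.

Lemma normr_dot_le x u : enorm u = 1 -> `|dot x u| <= enorm x.
Proof.
move=> u1; rewrite -ler_sqr ?nnegrE ?normr_ge0 ?sqrtr_ge0 // enorm_sqr.
rewrite real_normK ?num_real //.
have := dot_ge0 (x - dot x u *: u).
rewrite dot_subZ -(enorm_sqr u) u1 expr1n mulr1 => ?; lra.
Qed.

Lemma mx_norm_le_enorm x : `|x| <= enorm x.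
Proof.
rewrite [leLHS]/Num.norm /= mx_normrE; apply: bigmax_le => [|[i j] _ /=].
  exact: sqrtr_ge0.
rewrite -ler_sqr ?nnegrE ?normr_ge0 ?sqrtr_ge0 // enorm_sqr.
rewrite real_normK ?num_real // /dot (bigD1 j) //= (ord1 i) expr2 lerDl.
by apply: sumr_ge0 => k _; rewrite -expr2 sqr_ge0.
Qed.

Lemma normr_coord_le x i : `|x ord0 i| <= `|x|.
Proof.
rewrite [leRHS]/Num.norm /= mx_normrE.
exact: (le_bigmax _ (fun ij : 'I_1 * 'I_n => `|x ij.1 ij.2|) (ord0, i)).
Qed.

Lemma enorm_le_mx_norm x : enorm x <= n%:R * `|x|.
Proof.
rewrite -ler_sqr ?nnegrE ?mulr_ge0 ?normr_ge0 ?sqrtr_ge0 // enorm_sqr.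
apply: (@le_trans _ _ (\sum_(i < n) `|x| ^+ 2)).
  apply: ler_sum => i _; rewrite -expr2 -real_normK ?num_real //.
  by rewrite ler_sqr ?nnegrE ?normr_ge0 // normr_coord_le.
rewrite sumr_const card_ord exprMn -[leLHS]mulr_natl ler_wpM2r ?sqr_ge0 //.
by rewrite -natrX ler_nat; case: (n) => // m; rewrite expnS leq_pmulr.
Qed.

Lemma dot_reflection H x :
  dot (reflection H x) (unit_normal H) = - dot x (unit_normal H).
Proof.
rewrite dotBl dotZl -(enorm_sqr (unit_normal H)) enorm_unit_normal.
ring.
Qed.

Lemma reflectionK H : involutive (reflection H).
Proof.
move=> x; rewrite {1}/reflection dot_reflection /reflection mulrN scaleNr opprK.
by rewrite subrK.
Qed.

Lemma reflection_fix H x : dot x (unit_normal H) = 0 -> reflection H x = x.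
Proof. by rewrite /reflection => ->; rewrite mulr0 scale0r subr0. Qed.

Lemma enorm_reflectionB H x y :
  enorm (reflection H x - reflection H y) = enorm (x - y).
Proof.
have -> : reflection H x - reflection H y = reflection H (x - y).
  rewrite /reflection dotBl mulrBr scalerBl; apply/rowP => i; rewrite !mxE.
  ring.
rewrite /enorm dot_subZ -(enorm_sqr (unit_normal H)) enorm_unit_normal.
by congr Num.sqrt; ring.
Qed.

End euclidean.

(** * A Caratheodory criterion for Hausdorff measure *)

Section caratheodory_criterion.
Context {R : realType} {n : nat}.
Implicit Types (A B X : set 'rV[R]_n) (d e : R).
Local Open Scope ereal_scope.

Lemma diam_le A d :
  (forall x y, A x -> A y -> (enorm (x - y) <= d)%R) -> diam A <= d%:E.
Proof.
by move=> Ad; apply: ge_ereal_sup => _ [x Ax [y Ay] <-]; rewrite lee_fin Ad.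
Qed.

Lemma enormB_le_diam A d x y :
  diam A <= d%:E -> A x -> A y -> (enorm (x - y) <= d)%R.
Proof.
move=> Ad Ax Ay; rewrite -lee_fin (le_trans _ Ad) //.
by apply: ereal_sup_ubound; exists x => //; exists y.
Qed.

Lemma hausdorff_weight0 : hausdorff_weight (set0 : set 'rV[R]_n) = 0.
Proof. by rewrite /hausdorff_weight eqxx. Qed.

Lemma hausdorff_delta_le A d e :
  (d <= e)%R -> hausdorff_delta e A <= hausdorff_delta d A.
Proof.
move=> de; apply: ereal_inf_le_tmp => _ [C [AC Cd] <-]; exists C => //.
by split => // k; rewrite (le_trans (Cd k)) // lee_fin.
Qed.

Lemma hausdorff_delta_le_hausdorff A d :
  (0 < d)%R -> hausdorff_delta d A <= hausdorff A.
Proof. by move=> d0; apply: ereal_sup_ubound; exists d. Qed.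

(** A set of diameter at most [d] cannot meet both [A] and [B], so a cover of
    the union splits into a cover of [A] and one of [B] at no extra cost. *)
Lemma hausdorff_delta_separated A B d e : (d < e)%R ->
  (forall x y, A x -> B y -> (e <= enorm (x - y))%R) ->
  hausdorff_delta d A + hausdorff_delta d B <= hausdorff_delta d (A `|` B).
Proof.
move=> de sep; apply: le_ereal_inf_tmp => _ [C [ABC Cd] <-].
pose part X k := if `[< C k `&` X !=set0 >] then C k else set0.
have partP X : X `<=` A `|` B ->
    hausdorff_delta d X <= \sum_(k <oo) hausdorff_weight (part X k).
  move=> XAB; apply: ereal_inf_lbound; exists (part X) => //; split.
    move=> x Xx; have [k _ Ckx] := ABC x (XAB x Xx); exists k => //.
    by rewrite /part asboolT //; exists x.
  move=> k; rewrite /part; case: asboolP => // _.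
  apply: (@le_trans _ _ -oo); last by rewrite leNye.
  by apply: ge_ereal_sup => _ [? []].
apply: (le_trans (leeD (partP A _) (partP B _))); [by left|by right|].
rewrite -nneseriesD; try by move=> *; exact: hausdorff_weight_ge0.
apply: lee_nneseries => [k _ _|k _].
  by rewrite adde_ge0 ?hausdorff_weight_ge0.
rewrite /part; case: asboolP => [[x [Cx Ax]]|_]; case: asboolP => [[y [Cy By]]|_];
  rewrite ?hausdorff_weight0 ?adde0 ?add0e ?hausdorff_weight_ge0 //.
have := lt_le_trans de (sep x y Ax By).
by rewrite ltNge (enormB_le_diam (Cd k)).
Qed.

(** The measure is the supremum over mesh sizes, which may be taken as small as
    wished, in particular below the separation [e]. *)
Lemma hausdorff_separated A B e : (0 < e)%R ->
  (forall x y, A x -> B y -> (e <= enorm (x - y))%R) ->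
  hausdorff A + hausdorff B <= hausdorff (A `|` B).
Proof.
move=> e0 sep; have [->|/eqP ABoo] := eqVneq (hausdorff (A `|` B)) +oo.
  by rewrite leey.
have ABfin : hausdorff (A `|` B) < +oo by rewrite ltey; exact/eqP.
have finB : hausdorff B \is a fin_num.
  rewrite ge0_fin_numE ?hausdorff_ge0 //; apply: le_lt_trans ABfin.
  by apply: le_hausdorff; exact: subsetUr.
rewrite -leeBrDr //; apply: ge_ereal_sup => _ [a a0 <-].
have finA : hausdorff_delta a A \is a fin_num.
  rewrite ge0_fin_numE ?hausdorff_delta_ge0 //; apply: le_lt_trans ABfin.
  apply: le_trans (hausdorff_delta_le_hausdorff _ a0) _.
  by apply: le_hausdorff; exact: subsetUl.
rewrite leeBrDr // addeC -leeBrDr //; apply: ge_ereal_sup => _ [b b0 <-].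
rewrite leeBrDr // addeC.
pose d := Num.min (Num.min a b) (e / 2)%R.
have d0 : (0 < d)%R by rewrite !lt_min a0 b0 divr_gt0.
have de : (d < e)%R.
  by rewrite (@le_lt_trans _ _ (e / 2)%R) ?ge_min ?lexx ?orbT // ltr_pdivrMr //; lra.
have da : (d <= a)%R by rewrite !ge_min lexx.
have db : (d <= b)%R by rewrite !ge_min lexx orbT.
apply: le_trans (hausdorff_delta_le_hausdorff _ d0).
apply: le_trans (hausdorff_delta_separated de sep).
by apply: leeD; exact: hausdorff_delta_le.
Qed.

(** Caratheodory's criterion for a metric outer measure.  The part of [X] where
    [g] exceeds [h k] is at positive distance from the part where [g <= 0], and
    it exhausts [X] intersected with [g > 0] up to the rings [Ring i], [i >= k].
    Rings of index differing by two or more are separated from each other, so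
    their measures have a sum bounded by twice the measure of [X], and the tail
    of this series tends to zero. *)
Lemma hausdorff_caratheodory_gt0 (g : 'rV[R]_n -> R) :
  (forall x y, g x - g y <= enorm (x - y))%R ->
  (@hausdorff R n).-caratheodory [set x | 0 < g x]%R.
Proof.
move=> glip; apply: le_caratheodory_measurable => X.
set G := [set x | _].
change (hausdorff (X `&` G) + hausdorff (X `&` ~` G) <= hausdorff X).
have [->|/eqP Xoo] := eqVneq (hausdorff X) +oo; first by rewrite leey.
have Xfin : hausdorff X \is a fin_num.
  by rewrite ge0_fin_numE ?hausdorff_ge0 // ltey; exact/eqP.
pose h k : R := (k.+1%:R^-1)%R.
have h_gt0 k : (0 < h k)%R by rewrite invr_gt0.
have h_lt k : (h k.+1 < h k)%R by rewrite ltf_pV2 ?posrE // ltr_nat.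
pose A k := X `&` [set x | h k < g x]%R.
pose Ring k := X `&` [set x | h k.+1 < g x <= h k]%R.
have AX k : A k `<=` X by exact: subIsetl.
have RA k : Ring k `<=` A k.+1 by move=> x [Xx /andP[]].
have sepA k (Y Z : set 'rV[R]_n) a :
    (a < h k)%R -> Y `<=` A k -> Z `<=` [set x | g x <= a]%R ->
    hausdorff Y + hausdorff Z <= hausdorff (Y `|` Z).
  move=> ak YA Za; apply: (@hausdorff_separated _ _ (h k - a)%R).
    by rewrite subr_gt0.
  move=> x y /YA[_ /= gx] /Za /= gy; apply: le_trans (glip x y); lra.
(* At each step the ring [k.+1] is absorbed by [A k], from which it is
   separated; the two summands on the right play the roles of the even and the
   odd rings. *)
have sumRA k : \sum_(i < k.+1) hausdorff (Ring i) <=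
    hausdorff (A k.+1) + hausdorff (A k).
  elim: k => [|k IH].
    rewrite big_ord_recl big_ord0 adde0.
    by rewrite (le_trans (le_hausdorff (RA 0%N))) // leeDl // hausdorff_ge0.
  rewrite big_ord_recr /= (le_trans (leeD2r _ IH)) //.
  rewrite -addeA addeC leeD2r //.
  apply: (le_trans (sepA k _ _ (h k.+1) (h_lt k) (@subset_refl _ _) _)).
    by move=> x [_ /andP[]].
  apply: le_hausdorff => x [[Xx /= gx]|/RA //]; split => //=.
  by rewrite (lt_trans _ gx) // (lt_trans (h_lt _)).
have sumR : \sum_(k <oo) hausdorff (Ring k) < +oo.
  apply: (@le_lt_trans _ _ (hausdorff X + hausdorff X)).
    apply: lime_le; first by apply: is_cvg_nneseries => *; exact: hausdorff_ge0.
    exists 1%N => // -[//|k _] /=; rewrite big_mkord (le_trans (sumRA k)) //.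
    by apply: leeD; exact: le_hausdorff.
  by rewrite ltey_eq fin_numD Xfin.
have tail := nneseries_tail_cvg sumR (fun k _ => hausdorff_ge0 (Ring k)).
apply/lee_addgt0Pr => e e0.
have [N tailN] : exists N, \sum_(N <= k <oo) hausdorff (Ring k) < e%:E.
  have /= := tail `]-oo, e%:E[%classic; case.
    apply: open_nbhs_nbhs; split; first exact: open_ereal_lt_ereal.
    by rewrite /= in_itv /= lte_fin.
  by move=> N _ /(_ N (leqnn _)) /=; rewrite in_itv /=; exists N.
have XG : X `&` G `<=` A N `|` \bigcup_(k in ~` `I_N) Ring k.
  move=> x [Xx /= gx].
  have ex : exists k, (h k < g x)%R.
    have [k _ /(_ k (leqnn _)) hk] := near_infty_natSinv_lt (PosNum gx).
    by exists k.
  have [k hk kmin] := ex_minnP ex.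
  have [kN|Nk] := leqP k N.
    left; split => //=; apply: le_lt_trans hk.
    by rewrite lef_pV2 ?posrE // ler_nat ltnS.
  right; exists k.-1; first by apply/negP; rewrite -leqNgt -ltnS (ltn_predK Nk).
  split => //=; rewrite (ltn_predK Nk) hk leNgt.
  by apply/negP => /kmin; rewrite -ltnS (ltn_predK Nk) ltnn.
apply: (@le_trans _ _ (hausdorff (A N) + e%:E + hausdorff (X `&` ~` G))).
  rewrite leeD2r // (le_trans (le_hausdorff XG)) //.
  rewrite (le_trans (outer_measureU2 _ _ _)) // leeD2l //.
  exact: le_trans (outer_measure_sigma_subadditive_tail _ _ _) (ltW tailN).
rewrite -addeA (addeC e%:E) addeA leeD2r //.
apply: (le_trans (sepA N _ _ 0%R (h_gt0 N) (@subset_refl _ _) _)).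
  by move=> x [_ /= /negP]; rewrite -leNgt.
by apply: le_hausdorff => x [/AX|[]].
Qed.

End caratheodory_criterion.

(** * Counting grid points in a cube *)

Section grid_count.
Context {R : realType} {n : nat}.
Implicit Types (x y : 'rV[R]_n) (M : nat).

(** An open interval of length at most [m / M] holds at most [m] points of a
    progression of step [1 / M]: all of them lie among the [m] consecutive ones
    from the least on. *)
Lemma card_grid_interval M (a c r : R) (m : nat) :
  (0 < M)%N -> 2 * r * M%:R <= m%:R ->
  (#|[pred j : 'I_M | (`|a + j%:R / M%:R - c| < r)%R]| <= m)%N.
Proof.
move=> M0 rm; set S := [pred j : 'I_M | _].
have [j0 Sj0|S0] := pickP S; last by rewrite eq_card0.
have [i /= Si imin] := arg_minnP (fun j : 'I_M => j : nat) Sj0.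
rewrite cardE -(size_map val) -(size_iota i m); apply: uniq_leq_size.
  by rewrite map_inj_uniq ?enum_uniq //; exact: val_inj.
move=> _ /mapP[j + ->] /=; rewrite mem_enum mem_iota => Sj.
rewrite imin //=; have := Sj; rewrite inE => Sj'.
have M0' : 0 < M%:R :> R by rewrite ltr0n.
rewrite -(ltr_nat R) natrD -ltrBlDl (lt_le_trans _ rm) // -ltr_pdivrMr //.
move: Si Sj'; rewrite /S /= !ltr_norml mulrBl; lra.
Qed.

Definition grid_point x0 M (phi : {ffun 'I_n -> 'I_M}) : 'rV[R]_n :=
  x0 + \row_i ((phi i)%:R / M%:R).

Lemma card_grid_ball M x0 y (r : R) (m : nat) :
  (0 < M)%N -> 2 * r * M%:R <= m%:R ->
  (#|[pred phi : {ffun 'I_n -> 'I_M} |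
    (`|grid_point x0 phi - y| < r)%R]| <= m ^ n)%N.
Proof.
move=> M0 rm.
pose F i := [pred j : 'I_M | `|x0 ord0 i + j%:R / M%:R - y ord0 i| < r].
apply: (@leq_trans #|family F|).
  apply/subset_leq_card/fintype.subsetP => phi; rewrite inE => phir.
  apply/familyP => i; rewrite inE; apply: le_lt_trans phir.
  by have := normr_coord_le (grid_point x0 phi - y) i; rewrite !mxE.
rewrite card_family foldrE big_map big_enum /=.
apply: (@leq_trans (\prod_(i < n) m)); last by rewrite prod_nat_const card_ord.
by apply: leq_prod => i _; exact: card_grid_interval.
Qed.

(** This replaces a comparison of Lebesgue volumes: on a grid of mesh [1 / M],
    a ball of radius [r] for the maximum norm contains at most
    [(2 r M + 1) ^ n] of the [M ^ n] points, and [2 r M + 1 <= 3 r M] as soon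
    as [M] exceeds [1 / r]. *)
Lemma cube_cover_volume x0 (N : nat) (y : nat -> 'rV[R]_n) (r : nat -> R) :
  (forall k, 0 < r k) ->
  (forall x, `|x - x0| <= 1 -> exists2 k, (k < N)%N & `|x - y k| < r k) ->
  1 <= \sum_(k < N) (3 * r k) ^+ n.
Proof.
move=> r0 cov.
pose M := (\max_(k < N) (Num.truncn (r k)^-1).+1).+1.
have M0 : 0 < M%:R :> R by rewrite ltr0n.
have rM (k : 'I_N) : 1 <= r k * M%:R.
  rewrite -ler_pdivrMl // mulr1 (le_trans (ltW (truncnS_gt _))) // ler_nat.
  by rewrite leqW // (leq_bigmax k).
pose m k := (Num.truncn (2 * r k * M%:R)).+1.
have m_le (k : 'I_N) : (m k)%:R <= 3 * r k * M%:R.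
  have := rM k; have : (Num.truncn (2 * r k * M%:R))%:R <= 2 * r k * M%:R.
    by rewrite truncn_le !mulr_ge0 // ltW.
  rewrite /m -natr1; lra.
have count : (M ^ n <= \sum_(k < N) m k ^ n)%N.
  have -> : (M ^ n = #|{ffun 'I_n -> 'I_M}|)%N by rewrite card_ffun !card_ord.
  apply: (@leq_trans (\sum_(phi : {ffun 'I_n -> 'I_M})
      \sum_(k < N) ((`|grid_point x0 phi - y k| < r k)%R : nat))).
    rewrite -sum1_card; apply: leq_sum => phi _.
    have [|k kN kphi] := cov (grid_point x0 phi).
      rewrite addrC addKr [leLHS]/Num.norm /= mx_normrE.
      apply: bigmax_le => // -[a i] _ /=; rewrite mxE normrM normfV !normr_nat.
      by rewrite ler_pdivrMr // mul1r ler_nat ltnW.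
    by rewrite (bigD1 (Ordinal kN)) //= kphi.
  rewrite exchange_big /=; apply: leq_sum => k _.
  rewrite -big_mkcond /= sum1_card; apply: card_grid_ball => //.
  exact/ltW/truncnS_gt.
have Mn0 : 0 < M%:R ^+ n :> R by rewrite exprn_gt0.
rewrite -(ler_pM2r Mn0) mul1r -natrX.
apply: (@le_trans _ _ (\sum_(k < N) m k ^ n)%:R); first by rewrite ler_nat.
rewrite natr_sum mulr_suml; apply: ler_sum => k _.
by rewrite natrX natrX -exprMn lerXn2r // nnegrE ?mulr_ge0 // ltW.
Qed.

End grid_count.

(** * A cube has positive finite Hausdorff measure *)

Section cube_measure.
Context {R : realType} {n : nat}.
Implicit Types (A : set 'rV[R]_n) (x y : 'rV[R]_n).
Local Open Scope ereal_scope.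

Definition cube (x0 : 'rV[R]_n) : set 'rV[R]_n := [set x | `|x - x0| <= 1]%R.

Lemma cube_compact x0 : compact (cube x0).
Proof.
apply: bounded_closed_compact.
  exists (`|x0| + 1)%R; split; first exact: num_real.
  move=> M ltM x /= xx0; apply: le_trans (ltW ltM).
  by have := ler_normD (x - x0)%R x0; rewrite subrK; move: xx0; rewrite /cube /=; lra.
rewrite (_ : cube x0 = closed_ball x0 1).
  exact: closed_ball_closed.
rewrite closed_ballE //; apply/seteqP; split => x;
  by rewrite /cube /closed_ball_ /= distrC.
Qed.

Local Notation c := (ball_volume R n / 2 ^+ n)%R.

Let c_gt0 : (0 < c)%R.
Proof. by rewrite divr_gt0 ?exprn_gt0 // ball_volume_gt0. Qed.

(** The radius [yL.2] and centre [yL.1] stand for the diameter and a point of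
    [A]; radius zero makes the formula hold for the empty set as well. *)
Lemma hausdorff_weight_radius A (d : R) : (0 < n)%N -> (0 <= d)%R ->
  diam A <= d%:E -> exists yL : 'rV[R]_n * R,
  [/\ (0 <= yL.2 <= d)%R, hausdorff_weight A = (c * yL.2 ^+ n)%:E &
      forall x, A x -> (enorm (x - yL.1) <= yL.2)%R].
Proof.
move=> n0 d0 Ad; rewrite /hausdorff_weight.
have [->|/set0P A0] := eqVneq A set0.
  by exists (0, 0)%R; split => //=; rewrite ?lexx ?d0 // expr0n eqn0Ngt n0 mulr0.
have A_ge0 := diam_ge0 A0.
have Afin : diam A \is a fin_num.
  by rewrite ge0_fin_numE // (le_lt_trans Ad) // ltry.
case: A0 => y Ay; exists (y, fine (diam A)); split => /=.
- by rewrite fine_ge0 //= -lee_fin fineK.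
- by rewrite [RHS]EFinM EFin_expe fineK.
- by move=> x Ax; apply: (@enormB_le_diam _ _ A) => //; rewrite fineK.
Qed.

Lemma hausdorff_delta_fin_cover (I : finType) (C : I -> set 'rV[R]_n) A (d : R) :
  (forall x, A x -> exists i, C i x) -> (forall i, diam (C i) <= d%:E) ->
  hausdorff_delta d A <= \sum_(i : I) hausdorff_weight (C i).
Proof.
move=> AC Cd; pose s := [seq C i | i <- enum I].
apply: ereal_inf_lbound; exists (nth set0 s).
  split=> [x /AC[i Cix]|k].
    exists (enum_rank i) => //=.
    by rewrite (nth_map i) -?cardE ?ltn_ord // nth_enum_rank.
  have [ks|sk] := ltnP k (size s).
    by have /mapP[i _ ->] := mem_nth set0 ks.
  by rewrite nth_default //; apply: diam_le.
rewrite (nneseries_split _ (size s)); last by move=> *; exact: hausdorff_weight_ge0.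
rewrite add0n [X in _ + X]eseries0 ?adde0; last first.
  by move=> k sk _; rewrite nth_default // hausdorff_weight0.
by rewrite -(big_nth set0 xpredT (@hausdorff_weight R n)) big_map big_enum.
Qed.

(** Cutting the cube into cells of side [1 / N] costs at most [(3 N) ^ n] cells
    of diameter at most [n / N], a total weight bounded independently of [N]. *)
Lemma hausdorff_cube_lty x0 : (0 < n)%N -> hausdorff (cube x0) < +oo.
Proof.
move=> n0; apply: (@le_lt_trans _ _ (c * (3 * n%:R) ^+ n)%:E); last exact: ltry.
apply: ge_ereal_sup => _ [d d0 <-].
pose N := (Num.truncn (n%:R / d)%R).+1.
have N0 : (0 < N%:R :> R)%R by rewrite ltr0n.
have nNd : (n%:R / N%:R <= d)%R.
  by rewrite ler_pdivrMr // mulrC -ler_pdivrMr // ltW // truncnS_gt.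
apply: (le_trans (hausdorff_delta_le _ nNd)).
pose u x i := (N%:R * (x ord0 i - x0 ord0 i + 1))%R.
pose C (phi : {ffun 'I_n -> 'I_(3 * N)}) : set 'rV[R]_n :=
  [set x | forall i, (phi i)%:R <= u x i < (phi i).+1%:R]%R.
have Cd phi : diam (C phi) <= (n%:R / N%:R)%:E.
  apply: diam_le => x y Cx Cy; apply: le_trans (enorm_le_mx_norm _) _.
  rewrite ler_wpM2l ?ler0n // [leLHS]/Num.norm /= mx_normrE.
  apply: bigmax_le => [|[a i] _ /=]; first by rewrite invr_ge0 ler0n.
  rewrite ord1 !mxE -(ler_pM2r N0) mulVf ?gt_eqF // -[N%:R in leLHS]ger0_norm ?(ltW N0) //.
  rewrite -normrM ler_norml.
  have := Cx i; have := Cy i; rewrite /u -!natr1 => /andP[? ?] /andP[? ?].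
  by apply/andP; split; lra.
apply: (@le_trans _ _ (\sum_phi hausdorff_weight (C phi))).
  apply: hausdorff_delta_fin_cover => // x; rewrite /cube /= => xx0.
  have uxi i : (0 <= u x i <= (2 * N)%:R)%R.
    have := normr_coord_le (x - x0)%R i; rewrite !mxE => /le_trans/(_ xx0).
    rewrite ler_norml natrM /u => /andP[? ?].
    apply/andP; split; first by apply: mulr_ge0; [exact: ltW|lra].
    by rewrite mulrC ler_pM2r //; lra.
  have uN i : (Num.truncn (u x i) < 3 * N)%N.
    case/andP: (uxi i) => u0 u2; rewrite truncn_lt_nat // (le_lt_trans u2) //.
    by rewrite ltr_nat ltn_pmul2r.
  exists [ffun i => Ordinal (uN i)] => i; rewrite ffunE /= truncn_itv //.
  by case/andP: (uxi i).
apply: (@le_trans _ _ (\sum_(phi : {ffun 'I_n -> 'I_(3 * N)})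
    (c * (n%:R / N%:R) ^+ n)%:E)).
  apply: lee_sum => phi _.
  have [|[y L] /= [/andP[L0 Ld] -> _]] := hausdorff_weight_radius n0 _ (Cd phi).
    by rewrite divr_ge0 // ltW.
  by rewrite lee_fin ler_pM2l // lerXn2r // nnegrE // divr_ge0 // ltW.
rewrite sumEFin sumr_const card_ffun !card_ord lee_fin -[leLHS]mulr_natl natrX.
rewrite mulrCA -exprMn natrM.
by rewrite (_ : (3 * N%:R * (n%:R / N%:R) = 3 * n%:R)%R) //; field; rewrite gt_eqF.
Qed.

Lemma exprD_le (a b : R) : (0 <= a)%R -> (0 <= b)%R ->
  ((a + b) ^+ n <= 2 ^+ n * (a ^+ n + b ^+ n))%R.
Proof.
move=> a0 b0; wlog ab : a b a0 b0 / (a <= b)%R.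
  move=> W; have [|/ltW] := leP a b; first exact: W.
  by rewrite addrC [(a ^+ n + _)%R]addrC; exact: W.
apply: (@le_trans _ _ ((2 * b) ^+ n)%R).
  by rewrite lerXn2r ?nnegrE ?addr_ge0 ?mulr_ge0 //; lra.
by rewrite exprMn ler_pM2l ?exprn_gt0 // lerDr exprn_ge0.
Qed.

Lemma sum_geometric_le (e : R) N : (0 <= e)%R ->
  (\sum_(k < N) e / 2 ^+ k.+1 <= e)%R.
Proof.
move=> e0; suff -> : (\sum_(k < N) e / 2 ^+ k.+1 = e - e / 2 ^+ N)%R.
  by rewrite gerBl divr_ge0 // exprn_ge0.
elim: N => [|N IH]; first by rewrite big_ord0 expr0 divr1 subrr.
rewrite big_ord_recr /= IH exprS; field.
by rewrite expf_neq0.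
Qed.

(** Each set of a countable cover is enlarged to an open ball for the maximum
    norm, at an arbitrarily small total cost; compactness leaves finitely many
    balls, whose radii are bounded below by the grid count. *)
Lemma hausdorff_cube_gt0 x0 : (0 < n)%N -> 0 < hausdorff (cube x0).
Proof.
move=> n0.
(* The grid count bounds the sum of the [L k ^+ n] plus the enlargements below by
   [6 ^- n]; half of that is granted to the enlargements. *)
pose eta : R := (2 * 6 ^+ n)^-1%R.
have eta0 : (0 < eta)%R by rewrite invr_gt0 mulr_gt0 ?exprn_gt0.
have eta1 : (eta <= 1)%R.
  by rewrite invf_le1 ?mulr_gt0 ?exprn_gt0 // -[leLHS]mulr1 ler_pM ?exprn_ege1 //; lra.
apply: (@lt_le_trans _ _ (c * eta)%:E); first by rewrite lte_fin mulr_gt0.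
apply: le_trans (hausdorff_delta_le_hausdorff _ ltr01).
apply: le_ereal_inf_tmp => _ [C [cov Cd] <-].
have [yL yLP] := choice (fun k => hausdorff_weight_radius n0 ler01 (Cd k)).
pose y k := (yL k).1; pose L k := (yL k).2.
have L0 k : (0 <= L k)%R by case: (yLP k) => /andP[].
pose e k : R := (eta / 2 ^+ k.+1)%R.
have e0 k : (0 < e k)%R by rewrite divr_gt0 // exprn_gt0.
have e1 k : (e k <= 1)%R.
  rewrite ler_pdivrMr ?exprn_gt0 // mul1r (le_trans eta1) // exprn_ege1 //; lra.
have Lycov : cube x0 `<=` cover setT (fun k => ball (y k) (L k + e k)).
  move=> x /cov[k _ Ckx]; exists k => //.
  rewrite -ball_normE /= distrC; apply: le_lt_trans (mx_norm_le_enorm _) _.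
  by case: (yLP k) => _ _ /(_ _ Ckx) /le_lt_trans; apply; rewrite ltrDl.
have : cover_compact (cube x0).
  by rewrite -compact_cover; exact: cube_compact.
move=> /(_ nat setT (fun k => ball (y k) (L k + e k))).
case=> [k _| // | D _ Dcov]; first by apply: ball_open; rewrite ltr_wpDl.
pose N := (\max_(k <- finmap.enum_fset D) k.+1)%N.
have vol : (1 <= \sum_(k < N) (3 * (L k + e k)) ^+ n)%R.
  apply: (@cube_cover_volume _ _ x0 N y (fun k => L k + e k)%R) => [k|x /Dcov[k kD]].
    by rewrite ltr_wpDl.
  rewrite -ball_normE /= distrC => ykx; exists k => //.
  exact: (leq_bigmax_seq (F := succn)).
have {}vol : (1 <= 6 ^+ n * (\sum_(k < N) L k ^+ n + eta))%R.
  apply: (le_trans vol); rewrite mulrDr mulr_sumr.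
  apply: le_trans (lerD (lexx _) (ler_wpM2l _ (sum_geometric_le N (ltW eta0)))).
    rewrite mulr_sumr -big_split; apply: ler_sum => k _ /=.
    rewrite -mulrDr exprMn (_ : 6 = 3 * 2)%R; last by lra.
    rewrite exprMn -mulrA ler_pM2l ?exprn_gt0 //.
    apply: le_trans (exprD_le _ (ltW (e0 k))) _ => //.
    by rewrite ler_pM2l ?exprn_gt0 // lerD2l ler_iXnr // ltW.
  by rewrite exprn_ge0.
apply: (@le_trans _ _ (\sum_(0 <= k < N) hausdorff_weight (C k))); last first.
  by apply: nneseries_lim_ge => *; exact: hausdorff_weight_ge0.
rewrite big_mkord (eq_bigr (fun k : 'I_N => (c * L k ^+ n)%:E)); last first.
  by move=> k _; case: (yLP k).
rewrite sumEFin lee_fin -mulr_sumr ler_pM2l //.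
have six0 : (0 < 6 ^+ n :> R)%R by rewrite exprn_gt0.
have eta6 : (6 ^+ n * eta = 2^-1)%R.
  by rewrite /eta invfM mulrCA divff ?mulr1 // gt_eqF.
rewrite -(ler_pM2l six0) eta6; move: vol; rewrite mulrDr eta6; lra.
Qed.

End cube_measure.

(** * Hausdorff measure and the reflection *)

Section reflection_invariance.
Context {R : realType} {n : nat} (H : oriented_hyperplane R n).
Implicit Types (A B X E : set 'rV[R]_n) (x y : 'rV[R]_n).
Local Open Scope ereal_scope.

Local Notation rho := (reflection H).

Lemma reflection_preimageK A : rho @^-1` (rho @^-1` A) = A.
Proof. by apply/seteqP; split => x; rewrite /preimage /= reflectionK. Qed.

Lemma hausdorff_weight_reflection A :
  hausdorff_weight (rho @^-1` A) = hausdorff_weight A.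
Proof.
rewrite /hausdorff_weight /diam.
have -> : (rho @^-1` A == set0) = (A == set0).
  apply/eqP/eqP => [A0|->]; last exact: preimage_set0.
  by rewrite -(reflection_preimageK A) A0 preimage_set0.
congr (if _ then _ else _ * ereal_sup _ ^+ n).
apply/seteqP; split => _ [x Ax [y Ay] <-].
  by exists (rho x) => //; exists (rho y) => //; rewrite enorm_reflectionB.
exists (rho x); first by rewrite /preimage /= reflectionK.
exists (rho y); first by rewrite /preimage /= reflectionK.
by rewrite enorm_reflectionB.
Qed.

Lemma hausdorff_reflection A : hausdorff (rho @^-1` A) = hausdorff A.
Proof.
wlog suff W : A / hausdorff (rho @^-1` A) <= hausdorff A.
  apply/eqP; rewrite eq_le W /=.
  by rewrite -[X in hausdorff X <= _]reflection_preimageK W.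
apply: ge_ereal_sup => _ [d d0 <-].
apply: le_trans (hausdorff_delta_le_hausdorff _ d0).
apply: le_ereal_inf_tmp => _ [C [AC Cd] <-].
apply: ereal_inf_lbound; exists (fun k => rho @^-1` C k).
  split => [x /AC[k _ Ck]|k]; first by exists k.
  apply: diam_le => x y Cx Cy; rewrite -(enorm_reflectionB H).
  exact: enormB_le_diam (Cd k) Cx Cy.
by apply: eq_eseriesr => k _; rewrite hausdorff_weight_reflection.
Qed.

Lemma caratheodory_reflection A :
  (@hausdorff R n).-caratheodory A -> (@hausdorff R n).-caratheodory (rho @^-1` A).
Proof.
move=> mA X; rewrite -(hausdorff_reflection X) mA.
rewrite -(hausdorff_reflection (_ `&` A)) -(hausdorff_reflection (_ `&` ~` A)).
by rewrite -[X in _ = hausdorff (X `&` _) + hausdorff (X `&` _)]reflection_preimageK.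
Qed.

Definition side_plus : set 'rV[R]_n := [set x | 0 < dot x (unit_normal H)]%R.
Definition side_minus : set 'rV[R]_n := [set x | dot x (unit_normal H) < 0]%R.

Lemma caratheodory_side_plus : (@hausdorff R n).-caratheodory side_plus.
Proof.
apply: hausdorff_caratheodory_gt0 => x y; rewrite -dotBl.
exact: le_trans (ler_norm _) (normr_dot_le _ (enorm_unit_normal H)).
Qed.

Lemma reflection_side_minus : rho @^-1` side_minus = side_plus.
Proof.
by apply/seteqP; split => x; rewrite /preimage /side_minus /side_plus /=
  dot_reflection oppr_lt0.
Qed.

Lemma caratheodory_side_minus : (@hausdorff R n).-caratheodory side_minus.
Proof.
rewrite -(reflection_preimageK side_minus) reflection_side_minus.
exact: caratheodory_reflection caratheodory_side_plus.
Qed.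

Lemma hausdorff_modular A B : (@hausdorff R n).-caratheodory A ->
  hausdorff A + hausdorff B = hausdorff (A `|` B) + hausdorff (A `&` B).
Proof.
move=> mA; rewrite (mA B) (mA (A `|` B)) setIUl setIid setIUl setICr set0U.
by rewrite setUidl // addeA addeAC [B `&` A]setIC -addeA [X in _ + X]addeC addeA.
Qed.

(** Folding the half-space on the negative side onto the positive one: the
    measure of [A] only depends on [A] inside the hyperplane and, for each pair
    of mirror points, on how many of the two belong to [A]. *)
Lemma hausdorff_fold A : (@hausdorff R n).-caratheodory A ->
  hausdorff A =
    hausdorff (A `&` [set x | dot x (unit_normal H) = 0%R]) +
    (hausdorff ((A `|` rho @^-1` A) `&` side_plus) +
     hausdorff (A `&` rho @^-1` A `&` side_plus)).
Proof.
move=> mA; rewrite (caratheodory_side_plus A).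
rewrite (caratheodory_side_minus (A `&` ~` side_plus)).
rewrite addeA addeC.
have -> : A `&` ~` side_plus `&` ~` side_minus =
    A `&` [set x | dot x (unit_normal H) = 0%R].
  apply/seteqP; split => x /=.
    move=> [[Ax /negP xp] /negP xm]; split => //.
    by move: xp xm; rewrite -!leNgt => xp xm; lra.
  by move=> [Ax x0]; rewrite /side_plus /side_minus /= x0 ltxx.
congr (_ + _).
have -> : A `&` ~` side_plus `&` side_minus = A `&` side_minus.
  apply/seteqP; split => x /=; first by move=> [[]].
  move=> [Ax xm]; split => //; split => // xp.
  by move: xm xp; rewrite /side_minus /side_plus /= => /ltW; rewrite leNgt => /negP.
rewrite -(hausdorff_reflection (A `&` side_minus)) preimage_setI.
rewrite reflection_side_minus [LHS]hausdorff_modular.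
  by rewrite -setIUl setIACA setIid.
exact: caratheodory_measurable_setI caratheodory_side_plus.
Qed.

End reflection_invariance.

(** * Recovering a pair from its threshold counts *)

Section two_values.
Context {R : realType}.
Implicit Types p q r s c t : R.

Lemma pair_setP p q r s :
  [set p; q] = [set r; s] -> (p = r /\ q = s) \/ (p = s /\ q = r).
Proof.
move=> e.
have pP : [set r; s] p by rewrite -e; left.
have qP : [set r; s] q by rewrite -e; right.
have rP : [set p; q] r by rewrite e; left.
have sP : [set p; q] s by rewrite e; right.
move: pP qP rP sP => /= -[->|->] [->|->] /=; [|by left|by right|].
  by move=> _ [->|->]; left.
by move=> [->|->] _; left.
Qed.

(** The number of entries above [t], as a function of [t >= c], determines a
    multiset of numbers that are all at least [c]. *)
Lemma threshold_count_eq p q r s c :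
  c <= p -> c <= q -> c <= r -> c <= s ->
  (forall t, c <= t -> ((t < p)%R + (t < q)%R = (t < r)%R + (t < s)%R)%N) ->
  [set p; q] = [set r; s].
Proof.
wlog pq : p q / p <= q.
  move=> W cp cq cr cs E; have [pq|/ltW qp] := leP p q; first exact: W.
  by rewrite setUC; apply: W => // t ct; rewrite addnC E.
wlog rs : r s / r <= s.
  move=> W cp cq cr cs E; have [rs|/ltW sr] := leP r s; first exact: W.
  by rewrite (setUC [set r]); apply: W => // t ct; rewrite E // addnC.
move=> cp cq cr cs E.
have qs : q = s.
  apply/eqP; rewrite eq_le; apply/andP; split.
    have := E s cs; rewrite ltxx (ltNge s r) rs /= !addn0.
    by rewrite leNgt; case: (s < q); rewrite ?addn1.
  have := E q cq; rewrite ltxx (ltNge q p) pq /= !addn0.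
  by rewrite leNgt; case: (q < s); rewrite ?addn1.
subst s; have pr t : c <= t -> (t < p) = (t < r).
  by move=> /E /addIn; case: (t < p) (t < r) => -[].
suff -> : p = r by [].
apply/eqP; rewrite eq_le; apply/andP; split.
  by rewrite leNgt pr // ltxx.
by rewrite leNgt -pr // ltxx.
Qed.

End two_values.

(** * Two-valued test functions *)

Lemma measurable_fun_if_mem {R : realType} d (T : measurableType d) (A : set T)
    (g : T -> R) (a : R) :
  measurable A -> measurable_fun setT g ->
  measurable_fun setT (fun x => if x \in A then a else g x).
Proof.
move=> mA mg; apply: measurable_fun_ifT; [|exact: measurable_cst|exact: mg].
by apply: (measurable_fun_bool true); rewrite setTI preimage_mem_true.
Qed.

Section test_functions.
Context {R : realType} {n : nat} (H : oriented_hyperplane R n).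
Implicit Types (x y : 'rV[R]_n) (r s c t : R).

Local Notation nu := (unit_normal H).
Local Notation rho := (reflection H).

Lemma caratheodory_cube (x0 : 'rV[R]_n) :
  (@hausdorff R n).-caratheodory (cube x0).
Proof.
have -> : cube x0 = ~` [set x | 0 < `|x - x0| - 1].
  by apply/seteqP; split => x /=; rewrite /cube /= subr_gt0 leNgt => /negP.
apply/caratheodory_measurable_setC/hausdorff_caratheodory_gt0 => x y.
apply: le_trans (mx_norm_le_enorm _).
have := ler_normD (x - y) (y - x0); rewrite addrA subrK; lra.
Qed.

(** The centre is far enough from the hyperplane for the whole cube to lie
    strictly on the positive side: the maximum norm is at most one on the cube,
    hence the Euclidean distance to the centre is at most [n]. *)
Definition test_cube : set 'rV[R]_n := cube (n.+1%:R *: nu).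

Lemma test_cube_side : test_cube `<=` side_plus H.
Proof.
move=> x; rewrite /test_cube /cube /side_plus /=.
set x0 := n.+1%:R *: nu => xx0.
have -> : dot x nu = n.+1%:R + dot (x - x0) nu.
  by rewrite dotBl dotZl -(enorm_sqr nu) enorm_unit_normal expr1n mulr1 subrKC.
have := normr_dot_le (x - x0) (enorm_unit_normal H).
rewrite ler_norml => /andP[+ _]; have := enorm_le_mx_norm (x - x0).
have : n%:R * `|x - x0| <= n%:R by rewrite ler_piMr ?ler0n.
rewrite -natr1; lra.
Qed.

Lemma test_cube_reflection x : test_cube x -> ~ test_cube (rho x).
Proof.
move=> /test_cube_side xp /test_cube_side; move: xp.
by rewrite /side_plus /= dot_reflection oppr_gt0 => /ltW; rewrite leNgt => /negP.
Qed.

Definition test_fun r s c x : R :=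
  if x \in test_cube then r else if x \in rho @^-1` test_cube then s else c.

Lemma test_fun_plus r s c x : test_cube x -> test_fun r s c x = r.
Proof. by move=> xE; rewrite /test_fun mem_set. Qed.

Lemma test_fun_minus r s c x : test_cube (rho x) -> test_fun r s c x = s.
Proof.
move=> xE; rewrite /test_fun memNset ?mem_set //.
by have := test_cube_reflection xE; rewrite reflectionK.
Qed.

Lemma test_fun_out r s c x :
  ~ test_cube x -> ~ test_cube (rho x) -> test_fun r s c x = c.
Proof. by move=> xE xE'; rewrite /test_fun !memNset. Qed.

Lemma test_fun_cst c : test_fun c c c = cst c.
Proof. by apply/funext => x; rewrite /test_fun; case: ifP => // _; case: ifP. Qed.

Lemma test_fun_M r s c : M_class (test_fun r s c).
Proof.
have mE : measurable (test_cube : set (hausdorff_sigma_type R n)).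
  exact: caratheodory_cube.
have mE' : measurable (rho @^-1` test_cube : set (hausdorff_sigma_type R n)).
  exact: caratheodory_reflection (caratheodory_cube _).
exact: measurable_fun_if_mem r mE (measurable_fun_if_mem s mE' (measurable_cst c)).
Qed.

(** As [t >= c], only the cube and its mirror image, which have equal measure,
    contribute. *)
Lemma hausdorff_test_fun r s c t : c <= t ->
  hausdorff [set x | t < test_fun r s c x] =
  (((t < r)%R + (t < s)%R)%N%:R%:E * hausdorff test_cube)%E.
Proof.
move=> ct; rewrite (caratheodory_cube (n.+1%:R *: nu) [set x | _]) -/test_cube.
have -> : [set x | t < test_fun r s c x] `&` test_cube =
    if t < r then test_cube else set0.
  apply/seteqP; split => x /=.
    by move=> [+ xE]; rewrite test_fun_plus // => ->.
  by case: ifP => // tr xE; rewrite test_fun_plus.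
have -> : [set x | t < test_fun r s c x] `&` ~` test_cube =
    if t < s then rho @^-1` test_cube else set0.
  apply/seteqP; split => x /=.
    move=> [tx xE]; have [xE'|xE'] := pselect (test_cube (rho x)).
      by move: tx; rewrite test_fun_minus // => ->.
    by move: tx; rewrite test_fun_out // ltNge ct.
  case: ifP => // ts xE; rewrite test_fun_minus //; split => //.
  by have := test_cube_reflection xE; rewrite reflectionK.
rewrite natrD EFinD ge0_muleDl ?lee_fin ?ler0n //.
by congr (_ + _)%E; case: ifP => _; rewrite ?hausdorff_reflection ?hausdorff0
  ?mul1e ?mul0e.
Qed.

Hypothesis n0 : (0 < n)%N.

Lemma hausdorff_test_fun_lty r s c t : c <= t ->
  (hausdorff_measure [set x | (t < test_fun r s c x)%R] < +oo)%E.
Proof.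
move=> ct; rewrite /hausdorff_measure hausdorff_test_fun //.
by rewrite lte_mul_pinfty // ?lee_fin ?ler0n // hausdorff_cube_lty.
Qed.

Lemma test_fun_S r s c : c <= r -> c <= s -> S_class (test_fun r s c).
Proof.
move=> cr cs; split; first exact: test_fun_M.
move=> t; have [ct _|tc] := leP c t; first exact: hausdorff_test_fun_lty.
rewrite ltNge => /negP[]; apply: (@le_trans _ _ c%:E).
  by rewrite lee_fin ltW.
apply: ess_inf_ler => x; rewrite lee_fin /test_fun.
by case: ifP => // _; case: ifP.
Qed.

Lemma test_fun_Mplus r s c : 0 <= r -> 0 <= s -> 0 <= c ->
  Mplus_class (test_fun r s c).
Proof.
move=> r0 s0 c0; split; first exact: test_fun_M.
by move=> x; rewrite /test_fun; case: ifP => // _; case: ifP.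
Qed.

Lemma test_fun_V r s : 0 <= r -> 0 <= s -> V_class (test_fun r s 0).
Proof.
move=> r0 s0; split; first exact: test_fun_Mplus.
by move=> t t0; apply: hausdorff_test_fun_lty; exact: ltW.
Qed.

End test_functions.

(** * Pointwise maps *)

Section two_point_maps.
Context {R : realType} {n : nat} (H : oriented_hyperplane R n).
Context (X : set ('rV[R]_n -> R)).
Hypothesis X_class :
  X = M_class \/ X = Mplus_class \/ X = S_class \/ X = V_class.

Local Notation rho := (reflection H).

Lemma class_measurable f : X f -> M_class f.
Proof. by case: X_class => [|[|[|]]] ->; [|case|case|case=> -[]]. Qed.

Lemma class_superlevel f t : X f ->
  (@hausdorff R n).-caratheodory [set x | t < f x].
Proof.
move=> /class_measurable mf.
have := mf measurableT `]t, +oo[%classic (measurable_itv _).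
rewrite setTI; congr (_.-caratheodory _).
by apply/seteqP; split => x; rewrite /preimage /= in_itv /= andbT.
Qed.

(** When functions of the class may take negative values, any background value
    [c] is possible and the least of the four numbers serves.  In the other two
    classes all four are nonnegative and [c] is zero, the only background
    value that leaves superlevel sets of functions in [V_class] finite. *)
Lemma test_fun_class p q r s : (0 < n)%N ->
  value_set X p -> value_set X q -> value_set X r -> value_set X s ->
  exists c, [/\ c <= p, c <= q, c <= r & c <= s] /\
    (X (test_fun H r s c) /\ X (cst c)).
Proof.
move=> n0; pose c := Num.min (Num.min p q) (Num.min r s).
have [cp cq cr cs] : [/\ c <= p, c <= q, c <= r & c <= s].
  by split; rewrite !ge_min lexx ?orbT.
case: X_class => [|[|[|]]] ->.
- move=> _ _ _ _; exists c; do 2 split => //; first exact: test_fun_M.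
  by rewrite -(test_fun_cst H); exact: test_fun_M.
- move=> [f [_ f0] [x _ <-]] [g [_ g0] [y _ <-]].
  move=> [h [_ h0] [z _ <-]] [k [_ k0] [w _ <-]].
  exists 0; do 2 split => //; first exact: test_fun_Mplus.
  by rewrite -(test_fun_cst H); exact: test_fun_Mplus.
- move=> _ _ _ _; exists c; do 2 split => //; first exact: test_fun_S.
  by rewrite -(test_fun_cst H); exact: test_fun_S.
- move=> [f [[_ f0] _] [x _ <-]] [g [[_ g0] _] [y _ <-]].
  move=> [h [[_ h0] _] [z _ <-]] [k [[_ k0] _] [w _ <-]].
  exists 0; do 2 split => //; first exact: test_fun_V.
  by rewrite -(test_fun_cst H); exact: test_fun_V.
Qed.

Context (T : {fun X >-> X})
  (Fplus Fminus : {fun value_set X `*` value_set X >-> value_set X}).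
Hypothesis T_pointwise : pointwise_map H X T Fplus Fminus.

Lemma pointwise_side_plus f x : X f -> side_plus H x ->
  T f x = Fplus (f x, f (rho x)) /\ T f (rho x) = Fminus (f (rho x), f x).
Proof.
move=> Xf xp; have TP := T_pointwise.2 f Xf; split.
  by apply: (TP x).1; exact: ltW.
have := (TP (rho x)).2; rewrite reflectionK; apply.
by rewrite /halfspace_minus /= dot_reflection oppr_le0 ltW.
Qed.

Lemma pointwise_same_values f x : X f -> f (rho x) = f x ->
  T f x = Fplus (f x, f x).
Proof.
move=> Xf fx; have Dc : value_set X (f x) by exists f => //; exists x.
have [+ +] := T_pointwise.2 f Xf x; rewrite fx => TP TM.
have [x0|x0] := leP 0 (dot x (unit_normal H)); first exact: TP.
by rewrite (T_pointwise.1 _ Dc); apply: TM; exact: ltW.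
Qed.

(** On a pair of mirror points [T f] takes the two values of [f], possibly
    exchanged, so a superlevel set of [T f] has as many points in each such pair
    as that of [f]; the folding formula concludes. *)
Lemma equimeasurable_of_rearrangement :
  (forall r s, value_set X r -> value_set X s ->
    [set Fplus (r, s); Fminus (s, r)] = [set r; s]) ->
  equimeasurable X T.
Proof.
move=> F_swap f Xf t; rewrite /hausdorff_measure.
have Df x : value_set X (f x) by exists f => //; exists x.
have XTf : X (T f) by apply: (@funS _ _ _ _ T).
rewrite (hausdorff_fold H (class_superlevel t XTf)).
rewrite (hausdorff_fold H (class_superlevel t Xf)).
have swap x : side_plus H x -> (T f x = f x /\ T f (rho x) = f (rho x)) \/
    (T f x = f (rho x) /\ T f (rho x) = f x).
  move=> /(pointwise_side_plus Xf)[-> ->].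
  exact: pair_setP (F_swap _ _ (Df _) (Df _)).
congr (@hausdorff R n _ + (@hausdorff R n _ + @hausdorff R n _))%E.
- apply/seteqP; split => x [+ x0]; rewrite /= pointwise_same_values // ?reflection_fix //;
    by case: (pair_setP (F_swap _ _ (Df x) (Df x))) => -[-> _]; split.
- apply/seteqP; split => x [+ xp]; rewrite /preimage /=;
    by case: (swap x xp) => -[-> ->] [?|?]; split => //; [left|right|right|left].
- apply/seteqP; split => x [+ xp]; rewrite /preimage /=;
    by case: (swap x xp) => -[-> ->] [? ?].
Qed.

(** Applied to the test function with values [r] and [s], [T] yields the test
    function with values [p] and [q] over the same background; equal measures
    of superlevel sets then mean equal threshold counts. *)
Lemma rearrangement_of_equimeasurable : (0 < n)%N -> equimeasurable X T ->
  forall r s, value_set X r -> value_set X s ->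
    [set Fplus (r, s); Fminus (s, r)] = [set r; s].
Proof.
move=> n0 T_equi r s Dr Ds.
set p := Fplus (r, s); set q := Fminus (s, r).
have Dp : value_set X p by apply: (@funS _ _ _ _ Fplus).
have Dq : value_set X q by apply: (@funS _ _ _ _ Fminus).
have [c [[cp cq cr cs] [Xf Xc]]] := test_fun_class n0 Dp Dq Dr Ds.
set f := test_fun H r s c in Xf.
have E_gt0 : (0 < hausdorff (test_cube H))%E by exact: hausdorff_cube_gt0.
have Efin : hausdorff (test_cube H) \is a fin_num.
  by rewrite ge0_fin_numE ?hausdorff_ge0 // hausdorff_cube_lty.
(* Constants are fixed by [T]: all their superlevel sets are empty or full. *)
have Fcc : Fplus (c, c) = c.
  have Tc x : T (cst c) x = Fplus (c, c) by rewrite pointwise_same_values.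
  have T_gt0 : (0 < hausdorff [set: 'rV[R]_n])%E.
    exact: lt_le_trans E_gt0 (le_hausdorff (@subsetT _ _)).
  have lev t : (t < Fplus (c, c)) = (t < c).
    have := T_equi _ Xc t; rewrite /hausdorff_measure.
    under eq_set do rewrite Tc.
    have lvl a : hausdorff [set _ : 'rV[R]_n | t < a] =
        if t < a then hausdorff [set: 'rV[R]_n] else 0%E.
      case: ifP => ta; last rewrite -(@hausdorff0 R n);
        by congr (@hausdorff R n _); apply/seteqP; split.
    rewrite !lvl; case: ifP => _; case: ifP => _ // e.
      by move: T_gt0; rewrite e ltxx.
    by move: T_gt0; rewrite -e ltxx.
  by apply/eqP; rewrite eq_le !leNgt lev ltxx -lev ltxx.
have Tf : T f = test_fun H p q c.
  apply/funext => x; have [xE|xE] := pselect (test_cube H x).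
    have [-> _] := pointwise_side_plus Xf (test_cube_side xE).
    by rewrite /f !(test_fun_plus _ _ _ xE) test_fun_minus // reflectionK.
  have [xE'|xE'] := pselect (test_cube H (rho x)).
    have [_] := pointwise_side_plus Xf (test_cube_side xE').
    by rewrite reflectionK => ->; rewrite /f !(test_fun_minus _ _ _ xE') test_fun_plus.
  have fc : f x = c by exact: test_fun_out.
  have fc' : f (rho x) = c by apply: test_fun_out; rewrite ?reflectionK.
  by rewrite test_fun_out // pointwise_same_values // fc.
apply: (threshold_count_eq cp cq cr cs) => t ct.
have := T_equi _ Xf t; rewrite Tf /hausdorff_measure !hausdorff_test_fun //.
rewrite -(fineK Efin) -!EFinM => -[] /mulIf E.
apply/eqP; rewrite -(eqr_nat R); apply/eqP/E.
by rewrite gt_eqF // fine_gt0 // E_gt0 /= ltey_eq Efin.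
Qed.

End two_point_maps.

(** * The equivalence *)

Theorem theorem5p1 (R : realType) (n : nat) (n_ge2 : (2 <= n)%N)
  (H : oriented_hyperplane R n) (X : set ('rV[R]_n -> R))
  (X_class : X = M_class \/ X = Mplus_class \/ X = S_class \/ X = V_class)
  (T : {fun X >-> X})
  (Fplus Fminus : {fun value_set X `*` value_set X >-> value_set X})
  (T_pointwise : pointwise_map H X T Fplus Fminus) :
  equimeasurable X T <->
  forall r s : R, value_set X r -> value_set X s ->
    [set Fplus (r, s); Fminus (s, r)] = [set r; s].
Proof.
have n_gt0 : (0 < n)%N by exact: leq_trans n_ge2.
split; first exact: (rearrangement_of_equimeasurable X_class T_pointwise).
exact: (equimeasurable_of_rearrangement X_class T_pointwise).
Qed.
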